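(* Let $(f,g):(A,\mathfrak{g})\to(B,\mathfrak{h})$ be a morphism of Lie Rinehart pairs. The associated morphism $\bigwedge g_f:\bigwedge\mathfrak{g}_A\to\bigwedge\mathfrak{h}_B$ of exterior algebras is a morphism of graded Lie algebras with respect to the Schouten-Nijenhuis bracket.
   Context: A Lie Rinehart pair $(A,\mathfrak{g})$ consists of a real associative commutative algebra $A$ with unit, a real Lie algebra $\mathfrak{g}$, an $A$-module structure $(a,x)\mapsto a\cdot x$ on the vector space $\mathfrak{g}$, and a Lie algebra morphism $D:\mathfrak{g}\to \mathrm{Der}(A)$, $x\mapsto D_x$, into the Lie algebra of ($\mathbb{R}$-linear) derivations of $A$ (with commutator bracket), such that the Leibniz rule $[x,a\cdot y]=D_x(a)\cdot y+a\cdot[x,y]$ holds for all $x,y\in\mathfrak{g}$, $a\in A$. A morphism of Lie Rinehart pairs $(f,g):(A,\mathfrak{g})\to(B,\mathfrak{h})$ is a morphism $f:A\to B$ of real commutative associative unital algebras together with a morphism $g:\mathfrak{g}\to\mathfrak{h}$ of Lie algebras such that $g(a\cdot x)=f(a)\cdot g(x)$ and $f(D_x(a))=D_{g(x)}(f(a))$ for all $a\in A$, $x\in\mathfrak{g}$. $\bigwedge\mathfrak{g}_A=\bigoplus_{n\ge0}\bigwedge^n_A\mathfrak{g}$ is the exterior algebra of the $A$-module $\mathfrak{g}$, with $\bigwedge^0_A\mathfrak{g}=A$, $\bigwedge^1_A\mathfrak{g}=\mathfrak{g}$; the tensor degree of $x\in\bigwedge^n_A\mathfrak{g}$ is $|x|=n$.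 The associated morphism $\bigwedge g_f$ is given by $f(a)$ on scalars $a\in A$, by $g(x_1)\wedge\cdots\wedge g(x_n)$ on simple tensors $x_1\wedge\cdots\wedge x_n$, and extended by additivity. The (antisymmetric) Schouten-Nijenhuis bracket is the map $[\cdot,\cdot]:\bigwedge\mathfrak{g}_A\times\bigwedge\mathfrak{g}_A\to\bigwedge\mathfrak{g}_A$ defined by $[a,b]=0$ and $[x,a]=-[a,x]=D_x(a)$ for scalars $a,b\in A$ and vectors $x\in\mathfrak{g}$, by $$[x_1\wedge\cdots\wedge x_n,y_1\wedge\cdots\wedge y_m]=\sum_{i,j}(-1)^{i+j}[x_i,y_j]\wedge x_1\wedge\cdots\wedge\widehat{x_i}\wedge\cdots\wedge x_n\wedge y_1\wedge\cdots\wedge\widehat{y_j}\wedge\cdots\wedge y_m$$ on simple tensors ($x_i,y_j\in\mathfrak{g}$, $n,m\ge1$, hats denote omission), and extended to all of $\bigwedge\mathfrak{g}_A$ by additivity. Between a scalar $a\in A$ and a simple tensor with $n\ge 1$ factors it reads $$[x_1\wedge\cdots\wedge x_n,a]=\sum_i(-1)^{n-i}D_{x_i}(a)\cdot x_1\wedge\cdots\wedge\widehat{x_i}\wedge\cdots\wedge x_n,\qquad [a,x_1\wedge\cdots\wedge x_n]=\sum_i(-1)^{i}D_{x_i}(a)\cdot x_1\wedge\cdots\wedge\widehat{x_i}\wedge\cdots\wedge x_n.$$ A morphism of graded Lie algebras is an $\mathbb{R}$-linear map, homogeneous of degree $0$, commuting with the brackets. *)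

(* Defs.v *)
From HB Require Import structures.
From mathcomp Require Import all_boot all_algebra.
From mathcomp Require Import finmap zify.
From mathcomp Require Import boolp reals.
From mathcomp.multinomials Require Import monalg.

Set Implicit Arguments.
Unset Strict Implicit.
Unset Printing Implicit Defensive.

Import GRing.Theory.

Local Open Scope ring_scope.

(* The exterior algebra of the A-module g, as a graded A-module: the direct    *)
(* sum over n of the exterior powers is the free A-module on the words in g,   *)
(* modulo multilinearity and x /\ x = 0 for adjacent letters. A word of length *)
(* n stands for a simple n-tensor; the empty word spans the scalars A.         *)
Section Exterior.
Context {A : comPzRingType} (g : lmodType A).

Inductive ext_null : {malg A[seq g]} -> Prop :=
  | ext_null0 : ext_null 0
  | ext_nullB p q : ext_null p -> ext_null q -> ext_null (p - q)
  | ext_nullD a s t x y :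
      ext_null (<< a *g s ++ (x + y) :: t >>
                - << a *g s ++ x :: t >> - << a *g s ++ y :: t >>)
  | ext_nullZ a c s t x :
      ext_null (<< a *g s ++ (c *: x) :: t >> - << a * c *g s ++ x :: t >>)
  | ext_nullxx a s t x : ext_null << a *g s ++ x :: x :: t >>.

Definition ext_ideal : {pred {malg A[seq g]}} := [pred p | `[< ext_null p >]].

Fact ext_ideal_zmod_closed : zmod_closed ext_ideal.
Proof.
split=> [|p q]; rewrite !inE; first by apply/asboolP/ext_null0.
by move=> /asboolP p0 /asboolP q0; apply/asboolP/ext_nullB.
Qed.

HB.instance Definition _ :=
  GRing.isZmodClosed.Build {malg A[seq g]} ext_ideal ext_ideal_zmod_closed.

Definition exterior := {ideal_quot ext_ideal}.
HB.instance Definition _ := GRing.Zmodule.on exterior.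

End Exterior.

(* tensor a [:: x1; ...; xn] is a . x1 /\ ... /\ xn *)
HB.lock Definition tensor (A : comPzRingType) (g : lmodType A)
    (a : A) (s : seq g) : exterior g :=
  (\pi_(exterior g) << a *g s >>)%qT.

(* The additive map on exterior g given by psi on (coefficient, word) pairs;   *)
(* its value is meaningful when psi respects the defining relations.           *)
HB.lock Definition ext_lift (A : comPzRingType) (g : lmodType A) (M : zmodType)
    (psi : A -> seq g -> M) (u : exterior g) : M :=
  \sum_(s <- msupp (repr u)) psi (repr u)@_s s.

Section ExteriorTheory.
Context {A : comPzRingType} (g : lmodType A).
Local Notation exterior := (exterior g).
Local Notation tensor := (@tensor A g).
Local Notation ext_lift := (@ext_lift A g _).

Let tE a s : tensor a s = (\pi_exterior << a *g s >>)%qT.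
Proof. by rewrite tensor.unlock. Qed.

Lemma tensorDl a b s : tensor (a + b) s = tensor a s + tensor b s.
Proof. by rewrite !tE monalgUD raddfD. Qed.

Lemma tensor_eq0 (p : {malg A[seq g]}) : ext_null p -> \pi_exterior%qT p = 0.
Proof.
move=> p0; rewrite -(raddf0 \pi_exterior%qT).
by apply/eqP; rewrite -Quotient.idealrBE subr0 inE; apply/asboolP.
Qed.

Lemma tensorD a s t x y :
  tensor a (s ++ (x + y) :: t) = tensor a (s ++ x :: t) + tensor a (s ++ y :: t).
Proof.
rewrite !tE; have := tensor_eq0 (ext_nullD a s t x y).
by rewrite !raddfB /= -addrA -opprD => /eqP; rewrite subr_eq0 => /eqP.
Qed.

Lemma tensorZ a c s t x :
  tensor a (s ++ (c *: x) :: t) = tensor (a * c) (s ++ x :: t).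
Proof.
rewrite !tE; have := tensor_eq0 (ext_nullZ a c s t x); rewrite raddfB => /eqP.
by rewrite subr_eq0 => /eqP.
Qed.

Lemma tensorxx a s t x : tensor a (s ++ x :: x :: t) = 0.
Proof. by rewrite tE; exact/tensor_eq0/ext_nullxx. Qed.

Lemma ext_ind (P : exterior -> Prop) :
    (forall a s, P (tensor a s)) -> (forall u v, P u -> P v -> P (u + v)) ->
  forall u, P u.
Proof.
move=> Pt PD u; have P0 : P 0 by have := Pt 0 [::]; rewrite tE monalgU0 raddf0.
rewrite -[u]reprK [repr u]monalgE raddf_sum /=.
by elim/big_ind: _ => //= s _; rewrite -tE; exact: Pt.
Qed.

Section Lift.
Context (M : zmodType) (psi : A -> seq g -> M).

Let malg_lift (p : {malg A[seq g]}) : M := \sum_(s <- msupp p) psi p@_s s.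

Record ext_compat : Prop := ExtCompat {
  ext_compatDl : forall a b s, psi (a + b) s = psi a s + psi b s;
  ext_compatD : forall a s t x y,
    psi a (s ++ (x + y) :: t) = psi a (s ++ x :: t) + psi a (s ++ y :: t);
  ext_compatZ : forall a c s t x,
    psi a (s ++ (c *: x) :: t) = psi (a * c) (s ++ x :: t);
  ext_compatxx : forall a s t x, psi a (s ++ x :: x :: t) = 0 }.

Hypothesis psiP : ext_compat.

Let psi0 s : psi 0 s = 0.
Proof. by apply: (addIr (psi 0 s)); rewrite add0r -ext_compatDl // addr0. Qed.

Let malg_liftE (d : {fset seq g}) p : (msupp p `<=` d)%fset ->
  malg_lift p = \sum_(s <- d) psi p@_s s.
Proof.
move=> pd; rewrite /malg_lift (big_fset_incl _ pd) // => s _ sNp.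
by rewrite mcoeff_outdom.
Qed.

Let malg_lift0 : malg_lift 0 = 0.
Proof. by rewrite /malg_lift msupp0 big_nil. Qed.

Let malg_liftD p q : malg_lift (p + q) = malg_lift p + malg_lift q.
Proof.
pose d := (msupp p `|` msupp q)%fset.
rewrite (@malg_liftE d (p + q)) ?msuppD_le //.
rewrite (@malg_liftE d p) ?fsubsetUl // (@malg_liftE d q) ?fsubsetUr //.
by rewrite -big_split /=; apply: eq_bigr => s _; rewrite mcoeffD ext_compatDl.
Qed.

Let malg_liftB p q : malg_lift (p - q) = malg_lift p - malg_lift q.
Proof. by apply/eqP; rewrite -subr_eq opprK -malg_liftD subrK. Qed.

Let malg_liftU a s : malg_lift << a *g s >> = psi a s.
Proof.
by rewrite (@malg_liftE [fset s]%fset) ?msuppU_le // big_seq_fset1 mcoeffUU.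
Qed.

Let malg_lift_null p : ext_null p -> malg_lift p = 0.
Proof.
elim=> [|{}p q _ p0 _ q0|a s t x y|a c s t x|a s t x].
- exact: malg_lift0.
- by rewrite malg_liftB p0 q0 subr0.
- by rewrite !malg_liftB !malg_liftU ext_compatD // -addrA -opprD subrr.
- by rewrite malg_liftB !malg_liftU ext_compatZ // subrr.
- by rewrite malg_liftU ext_compatxx.
Qed.

Let ext_lift_pi p : ext_lift psi (\pi_exterior%qT p) = malg_lift p.
Proof.
rewrite unlock -/(malg_lift _).
apply/eqP; rewrite -subr_eq0 -malg_liftB; apply/eqP/malg_lift_null/asboolP.
have : repr (\pi_exterior%qT p) - p \in @ext_ideal A g.
  by rewrite Quotient.idealrBE reprK.
by rewrite inE.
Qed.

Lemma ext_liftD u v :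
  ext_lift psi (u + v) = ext_lift psi u + ext_lift psi v.
Proof.
by rewrite -[u]reprK -[v]reprK -raddfD /= !ext_lift_pi malg_liftD.
Qed.

Lemma ext_liftE a s : ext_lift psi (tensor a s) = psi a s.
Proof. by rewrite tE ext_lift_pi malg_liftU. Qed.
End Lift.

Definition ext_scale (c : A) : exterior -> exterior :=
  ext_lift (fun a s => tensor (c * a) s).

Let ext_scale_compat c : ext_compat (fun a s => tensor (c * a) s).
Proof.
split=> *; first by rewrite mulrDr tensorDl.
- exact: tensorD.
- by rewrite tensorZ mulrA.
- exact: tensorxx.
Qed.

Let ext_scaleE c a s : ext_scale c (tensor a s) = tensor (c * a) s.
Proof. exact: (ext_liftE (ext_scale_compat c)). Qed.

Let ext_scaleDr : right_distributive ext_scale +%R.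
Proof. by move=> c u v; apply: ext_liftD (ext_scale_compat c) u v. Qed.

Let ext_scaleA a b u : ext_scale a (ext_scale b u) = ext_scale (a * b) u.
Proof.
elim/ext_ind: u => [c s|u v IHu IHv]; first by rewrite !ext_scaleE mulrA.
by rewrite !ext_scaleDr IHu IHv.
Qed.

Let ext_scale1 : left_id 1 ext_scale.
Proof.
move=> u; elim/ext_ind: u => [c s|u v IHu IHv]; first by rewrite ext_scaleE mul1r.
by rewrite ext_scaleDr IHu IHv.
Qed.

Let ext_scaleDl u a b : ext_scale (a + b) u = ext_scale a u + ext_scale b u.
Proof.
elim/ext_ind: u => [c s|u v IHu IHv]; first by rewrite !ext_scaleE mulrDl tensorDl.
by rewrite !ext_scaleDr IHu IHv addrACA.
Qed.

HB.instance Definition _ := GRing.Zmodule_isLmodule.Build A exterior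
  ext_scaleA ext_scale1 ext_scaleDr ext_scaleDl.

Lemma scale_tensor (c a : A) s : c *: tensor a s = tensor (c * a) s.
Proof. exact: ext_scaleE. Qed.

Definition ext_scalar (a : A) : exterior := tensor a [::].

Definition wedge (s : seq g) : exterior := tensor 1 s.

Lemma tensorE a s : tensor a s = a *: wedge s.
Proof. by rewrite scale_tensor mulr1. Qed.

(* the exterior power of degree n, spanned over A by the simple n-tensors *)
Definition ext_homog (n : nat) (u : exterior) : Prop :=
  exists r : seq (A * n.-tuple g), u = \sum_(p <- r) p.1 *: wedge p.2.
End ExteriorTheory.

(* A real commutative unital algebra is a commutative ring A together with a   *)
(* ring morphism algr : R -> A, so that the zero algebra is allowed. The real  *)
(* vector space underlying the A-module g is its restriction along algr.       *)
Record lieRinehart (R : realType) (A : comPzRingType) (g : lmodType A) :=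
  LieRinehart {
  algr : {rmorphism R -> A};
  lie : g -> g -> g;
  anchor : g -> A -> A;
  lieDl : forall x y z, lie (x + y) z = lie x z + lie y z;
  lieDr : forall x y z, lie x (y + z) = lie x y + lie x z;
  lieZl : forall r x y, lie (algr r *: x) y = algr r *: lie x y;
  lieZr : forall r x y, lie x (algr r *: y) = algr r *: lie x y;
  liexx : forall x, lie x x = 0;
  lie_jacobi : forall x y z,
    lie x (lie y z) + lie y (lie z x) + lie z (lie x y) = 0;
  anchorDr : forall x a b, anchor x (a + b) = anchor x a + anchor x b;
  anchorZr : forall x r a, anchor x (algr r * a) = algr r * anchor x a;
  anchorM : forall x a b, anchor x (a * b) = anchor x a * b + a * anchor x b;
  anchorDl : forall x y a, anchor (x + y) a = anchor x a + anchor y a;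
  anchorZl : forall r x a, anchor (algr r *: x) a = algr r * anchor x a;
  anchor_lie : forall x y a,
    anchor (lie x y) a = anchor x (anchor y a) - anchor y (anchor x a);
  lie_leibniz : forall x a y, lie x (a *: y) = anchor x a *: y + a *: lie x y }.

Record lieRinehart_morphism (R : realType) (A B : comPzRingType)
    (g : lmodType A) (h : lmodType B) (L : lieRinehart R g) (M : lieRinehart R h)
    (f : {rmorphism A -> B}) (phi : {additive g -> h}) : Prop :=
  LieRinehartMorphism {
  morph_algr : forall r, f (algr L r) = algr M r;
  morph_real : forall r x, phi (algr L r *: x) = algr M r *: phi x;
  morph_lie : forall x y, phi (lie L x y) = lie M (phi x) (phi y);
  morph_scale : forall a x, phi (a *: x) = f a *: phi x;
  morph_anchor : forall a x, f (anchor L x a) = anchor M (phi x) (f a) }.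

Section ExteriorMap.
Context {A B : comPzRingType} {g : lmodType A} {h : lmodType B}.
Variables (f : {rmorphism A -> B}) (phi : {additive g -> h}).

Definition ext_map : exterior g -> exterior h :=
  ext_lift (fun a s => f a *: wedge (map phi s)).

Hypothesis phiZ : forall a x, phi (a *: x) = f a *: phi x.

Let ext_map_compat : ext_compat (fun a s => f a *: wedge (map phi s)).
Proof.
split=> *; rewrite ?map_cat /= -!tensorE.
- by rewrite rmorphD tensorDl.
- by rewrite raddfD tensorD.
- by rewrite phiZ tensorZ rmorphM.
- exact: tensorxx.
Qed.

Lemma ext_mapD u v : ext_map (u + v) = ext_map u + ext_map v.
Proof. exact: (ext_liftD ext_map_compat). Qed.

Lemma ext_mapE a s : ext_map (a *: wedge s) = f a *: wedge (map phi s).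
Proof. by rewrite -(tensorE a s) /ext_map (ext_liftE ext_map_compat). Qed.

Lemma ext_map_scalar a : ext_map (ext_scalar g a) = ext_scalar h (f a).
Proof. by rewrite /ext_scalar tensorE ext_mapE -tensorE. Qed.

Lemma ext_map_wedge s : ext_map (wedge s) = wedge (map phi s).
Proof. by rewrite -[wedge s]scale1r ext_mapE rmorph1 scale1r. Qed.
End ExteriorMap.

Definition del (T : Type) (i : nat) (s : seq T) : seq T :=
  take i s ++ drop i.+1 s.

(* Letters are indexed from 0: the i-th letter x_i of a simple tensor s, as    *)
(* counted in the usual formulas, is s`_(i-1), hence the i.+1 and j.+1 in the  *)
(* signs.                                                                      *)
Record is_schouten (R : realType) (A : comPzRingType) (g : lmodType A)
    (L : lieRinehart R g) (br : exterior g -> exterior g -> exterior g) : Prop :=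
  IsSchouten {
  schoutenDl : forall u v w, br (u + v) w = br u w + br v w;
  schoutenDr : forall u v w, br u (v + w) = br u v + br u w;
  schouten_scalar : forall a b, br (ext_scalar g a) (ext_scalar g b) = 0;
  schouten_wedge_scalar : forall (s : seq g) a, (0 < size s)%N ->
    br (wedge s) (ext_scalar g a) =
    \sum_(i < size s)
      ((-1) ^+ (size s - i.+1) * anchor L s`_i a) *: wedge (del i s);
  schouten_scalar_wedge : forall a (s : seq g), (0 < size s)%N ->
    br (ext_scalar g a) (wedge s) =
    \sum_(i < size s) ((-1) ^+ i.+1 * anchor L s`_i a) *: wedge (del i s);
  schouten_wedge : forall s t : seq g, (0 < size s)%N -> (0 < size t)%N ->
    br (wedge s) (wedge t) =
    \sum_(i < size s) \sum_(j < size t)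
      (-1) ^+ (i.+1 + j.+1) *: wedge (lie L s`_i t`_j :: del i s ++ del j t) }.

Record graded_lie_morphism (R : realType) (A B : comPzRingType)
    (g : lmodType A) (h : lmodType B) (L : lieRinehart R g) (M : lieRinehart R h)
    (brg : exterior g -> exterior g -> exterior g)
    (brh : exterior h -> exterior h -> exterior h)
    (F : exterior g -> exterior h) : Prop := GradedLieMorphism {
  graded_morphD : forall u v, F (u + v) = F u + F v;
  graded_morphZ : forall r u, F (algr L r *: u) = algr M r *: F u;
  graded_morph_homog : forall n u, ext_homog n u -> ext_homog n (F u);
  graded_morph_bracket : forall u v, F (brg u v) = brh (F u) (F v) }.

(* Existence of the bracket. It needs the anchor to be A-linear, which is not  *)
(* among the axioms of lieRinehart: without it there may be no bracket, e.g.   *)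
(* for a Poisson algebra A acting on g = A by D_x = {x, .}, where x /\ 1 = 0   *)
(* but the formula for the bracket of x /\ 1 with a scalar a gives - {x, a}.   *)
(* The bracket with a fixed element is built as the extension to words of a    *)
(* derivation: first [x, .] and [a, .] for x in g and a in A, then [., v].     *)
Section Existence.
Context {R : realType} {A : comPzRingType} {g : lmodType A}.
Variable L : lieRinehart R g.

Let lmul (x : g) : exterior g -> exterior g :=
  ext_lift (fun (a : A) s => tensor a (x :: s)).

Let lmul_compat (x : g) : ext_compat (fun (a : A) s => tensor a (x :: s)).
Proof.
split=> *; first exact: tensorDl.
- exact: (tensorD _ (_ :: _)).
- exact: (tensorZ _ _ (_ :: _)).
- exact: (tensorxx _ (_ :: _)).
Qed.

Let lmulD x u v : lmul x (u + v) = lmul x u + lmul x v.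
Proof. exact: (ext_liftD (lmul_compat x)). Qed.
Let lmulE x a s : lmul x (tensor a s) = tensor a (x :: s).
Proof. exact: (ext_liftE (lmul_compat x)). Qed.

Let lmulZ x c u : lmul x (c *: u) = c *: lmul x u.
Proof.
elim/(@ext_ind A g): u => [a s|u v IHu IHv]; first by rewrite !(scale_tensor, lmulE).
by rewrite scalerDr !lmulD IHu IHv scalerDr.
Qed.
Let lmul0 x : lmul x 0 = 0. Proof. by apply: (addIr (lmul x 0)); rewrite -lmulD !add0r. Qed.
Let lmulDl x y u : lmul (x + y) u = lmul x u + lmul y u.
Proof.
elim/(@ext_ind A g): u => [a s|u v IHu IHv].
  by rewrite !lmulE (tensorD _ [::]).
by rewrite !lmulD IHu IHv addrACA.
Qed.
Let lmulZl c x u : lmul (c *: x) u = c *: lmul x u.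
Proof.
elim/(@ext_ind A g): u => [a s|u v IHu IHv].
  by rewrite !lmulE (tensorZ _ _ [::]) scale_tensor mulrC.
by rewrite !lmulD IHu IHv scalerDr.
Qed.
Let lmulxx x u : lmul x (lmul x u) = 0.
Proof.
elim/(@ext_ind A g): u => [a s|u v IHu IHv]; first by rewrite !lmulE (tensorxx _ [::]).
by rewrite !lmulD IHu IHv addr0.
Qed.
Let lmulC x y u : lmul x (lmul y u) = - lmul y (lmul x u).
Proof.
apply/eqP; rewrite -addr_eq0; apply/eqP.
have := lmulxx (x + y) u; rewrite lmulDl !(lmulD, lmulDl, lmulxx).
by rewrite add0r addr0.
Qed.

Let lmuls (s : seq g) (u : exterior g) := foldr lmul u s.
Let lmuls_cat s t u : lmuls (s ++ t) u = lmuls s (lmuls t u).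
Proof. exact: foldr_cat. Qed.
Let lmulsD s u v : lmuls s (u + v) = lmuls s u + lmuls s v.
Proof. by elim: s => //= x s ->; rewrite lmulD. Qed.
Let lmulsZ s c u : lmuls s (c *: u) = c *: lmuls s u.
Proof. by elim: s => //= x s ->; rewrite lmulZ. Qed.
Let lmuls0 s : lmuls s 0 = 0.
Proof. by elim: s => //= x s ->; rewrite lmul0. Qed.
Let lmulsE s a t : lmuls s (tensor a t) = tensor a (s ++ t).
Proof. by elim: s => //= x s ->; rewrite lmulE. Qed.
Let lmulsC s x u : lmuls s (lmul x u) = (-1) ^+ size s *: lmul x (lmuls s u).
Proof.
elim: s => [|y s IHs] /=; first by rewrite scale1r.
by rewrite IHs lmulZ lmulC exprS mulN1r scaleNr scalerN.
Qed.

Section Derivation.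
Variables (E : g -> exterior g) (e : A -> exterior g).

Fixpoint sn_d (s : seq g) : exterior g :=
  if s is x :: s' then lmul x (sn_d s') + (-1) ^+ size s' *: lmuls s' (E x)
  else 0.

Definition sn_der a s := a *: sn_d s + lmuls s (e a).
Local Notation d := sn_d.
Local Notation der := sn_der.

Hypothesis (ED : forall x y, E (x + y) = E x + E y)
  (eD : forall a b, e (a + b) = e a + e b)
  (EZ : forall c x, E (c *: x) = c *: E x + lmul x (e c))
  (eM : forall a c, e (a * c) = a *: e c + c *: e a).

Let lmulsDm s t x y u :
  lmuls (s ++ (x + y) :: t) u = lmuls (s ++ x :: t) u + lmuls (s ++ y :: t) u.
Proof. by rewrite !lmuls_cat /= lmulDl lmulsD. Qed.
Let lmulsZm s t c x u : lmuls (s ++ c *: x :: t) u = c *: lmuls (s ++ x :: t) u.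
Proof. by rewrite !lmuls_cat /= lmulZl lmulsZ. Qed.
Let lmulsxx s t x u : lmuls (s ++ x :: x :: t) u = 0.
Proof. by rewrite !lmuls_cat /= lmulxx lmuls0. Qed.

Let dD s t x y : d (s ++ (x + y) :: t) = d (s ++ x :: t) + d (s ++ y :: t).
Proof.
elim: s => [|z s IHs] /=; first by rewrite lmulDl ED lmulsD scalerDr addrACA.
by rewrite IHs lmulD lmulsDm !size_cat scalerDr addrACA.
Qed.

Let dZ s t c x :
  d (s ++ c *: x :: t) = c *: d (s ++ x :: t) + lmuls (s ++ x :: t) (e c).
Proof.
elim: s => [|z s IHs] /=.
  rewrite lmulZl EZ lmulsD lmulsZ lmulsC !scalerDr !scalerA -expr2.
  by rewrite sqrr_sign scale1r (mulrC c) addrA.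
rewrite IHs lmulD lmulZ lmulsZm !size_cat /= scalerDr !scalerA (mulrC c).
by rewrite addrAC.
Qed.

Let dxx s t x : d (s ++ x :: x :: t) = 0.
Proof.
elim: s => [|z s IHs] /=.
  by rewrite lmulD lmulxx add0r lmulZ exprS mulN1r scaleNr subrr.
by rewrite IHs lmul0 lmulsxx scaler0 addr0.
Qed.

Lemma sn_der_compat : ext_compat der.
Proof.
rewrite /sn_der; split=> [a b s|a s t x y|a c s t x|a s t x].
- by rewrite scalerDl eD lmulsD addrACA.
- by rewrite dD lmulsDm scalerDr addrACA.
- by rewrite dZ lmulsZm eM lmulsD !lmulsZ scalerDr scalerA addrA.
- by rewrite dxx lmulsxx scaler0 addr0.
Qed.

Lemma sn_dE s : sn_d s =
  \sum_(i < size s) (-1) ^+ (size s - i.+1) *: lmuls (del i s) (E s`_i).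
Proof.
elim: s => [|x s IHs] /=; first by rewrite big_ord0.
rewrite big_ord_recl /= subn1 /= /del /= drop0 addrC IHs; congr (_ + _).
rewrite (big_morph _ (lmulD x) (lmul0 x)); apply: eq_bigr => i _.
by rewrite lmulZ.
Qed.
End Derivation.

Definition sn_adx x : exterior g -> exterior g :=
  ext_lift (sn_der (fun y => wedge [:: lie L x y])
                   (fun a => ext_scalar g (anchor L x a))).

Definition sn_ada c : exterior g -> exterior g :=
  ext_lift (fun a s => (-1) ^+ size s *:
    sn_der (fun y => ext_scalar g (anchor L y c)) (fun=> 0) a s).

Definition schouten u v : exterior g :=
  ext_lift (sn_der (sn_adx ^~ v) (sn_ada ^~ v)) u.

Hypothesis anchorA : forall a x b, anchor L (a *: x) b = a * anchor L x b.

Let anchor1 x : anchor L x 1 = 0.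
Proof.
by apply: (addIr (anchor L x 1)); rewrite add0r -[in RHS](mulr1 1) anchorM mulr1 mul1r.
Qed.

Let anchor0 x : anchor L x 0 = 0.
Proof. by apply: (addIr (anchor L x 0)); rewrite -anchorDr !add0r. Qed.

Let scalarD a b : ext_scalar g (a + b) = ext_scalar g a + ext_scalar g b.
Proof. exact: tensorDl. Qed.

Let scalar0 : ext_scalar g 0 = 0.
Proof. by apply: (addIr (ext_scalar g 0)); rewrite -scalarD !add0r. Qed.

Let adx_compat x : ext_compat (sn_der (fun y => wedge [:: lie L x y])
                                      (fun a => ext_scalar g (anchor L x a))).
Proof.
apply: sn_der_compat => [y z|a b|c y|a c].
- by rewrite lieDr /wedge (tensorD _ [::]).
- by rewrite anchorDr scalarD.
- by rewrite lie_leibniz /wedge (tensorD _ [::]) !(tensorZ _ _ [::]) !mul1r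
     scale_tensor mulr1 lmulE addrC.
- by rewrite anchorM scalarD !scale_tensor addrC (mulrC c).
Qed.

Let ada_compat c : ext_compat (fun a s => (-1) ^+ size s *:
  sn_der (fun y => ext_scalar g (anchor L y c)) (fun=> 0) a s).
Proof.
have [H1 H2 H3 H4] : ext_compat
    (sn_der (fun y => ext_scalar g (anchor L y c)) (fun=> 0)).
  apply: sn_der_compat => [y z|a b|b y|a b].
  - by rewrite anchorDl scalarD.
  - by rewrite addr0.
  - by rewrite anchorA lmul0 addr0 scale_tensor.
  - by rewrite !scaler0 addr0.
split=> *.
- by rewrite H1 scalerDr.
- by rewrite H2 scalerDr !size_cat.
- by rewrite H3 !size_cat.
- by rewrite H4 scaler0.
Qed.

Let adxE x a s : sn_adx x (tensor a s) =
  a *: sn_d (fun y => wedge [:: lie L x y]) s + tensor (anchor L x a) s.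
Proof. by rewrite /sn_adx (ext_liftE (adx_compat x)) /sn_der lmulsE cats0. Qed.

Let adaE c a s : sn_ada c (tensor a s) =
  (-1) ^+ size s * a *: sn_d (fun y => ext_scalar g (anchor L y c)) s.
Proof. by rewrite /sn_ada (ext_liftE (ada_compat c)) /sn_der lmuls0 addr0 scalerA. Qed.

Let adxD x u v : sn_adx x (u + v) = sn_adx x u + sn_adx x v.
Proof. exact: (ext_liftD (adx_compat x)). Qed.

Let adaD c u v : sn_ada c (u + v) = sn_ada c u + sn_ada c v.
Proof. exact: (ext_liftD (ada_compat c)). Qed.

Let sn_dD E F s : sn_d (fun y => E y + F y) s = sn_d E s + sn_d F s.
Proof.
elim: s => [|x s IHs] /=; first by rewrite addr0.
by rewrite IHs lmulD lmulsD scalerDr addrACA.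
Qed.

Let eq_sn_d E F s : E =1 F -> sn_d E s = sn_d F s.
Proof. by move=> EF; elim: s => //= x s ->; rewrite EF. Qed.

Let sn_dZ c E s : sn_d (fun y => c *: E y) s = c *: sn_d E s.
Proof.
elim: s => [|x s IHs] /=; first by rewrite scaler0.
by rewrite IHs lmulZ lmulsZ scalerDr !scalerA (mulrC c).
Qed.

Let adxDl x y u : sn_adx (x + y) u = sn_adx x u + sn_adx y u.
Proof.
elim/(@ext_ind A g): u => [a s|u v IHu IHv]; last by rewrite !adxD IHu IHv addrACA.
rewrite !adxE anchorDl tensorDl addrACA -(scalerDr a) -sn_dD; congr (_ *: _ + _).
by apply: eq_sn_d => z; rewrite lieDl /wedge (tensorD _ [::]).
Qed.

Let adaDl b c u : sn_ada (b + c) u = sn_ada b u + sn_ada c u.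
Proof.
elim/(@ext_ind A g): u => [a s|u v IHu IHv]; last by rewrite !adaD IHu IHv addrACA.
rewrite !adaE -(scalerDr (_ * a)) -sn_dD; congr (_ *: _).
by apply: eq_sn_d => z; rewrite anchorDr scalarD.
Qed.

Let adaM b c u : sn_ada (b * c) u = b *: sn_ada c u + c *: sn_ada b u.
Proof.
elim/(@ext_ind A g): u => [a s|u v IHu IHv].
  rewrite !adaE; move: (_ ^+ _ * a) => k.
  rewrite !scalerA (mulrC b k) (mulrC c k) -!scalerA -scalerDr -(sn_dZ b) -(sn_dZ c) -sn_dD.
  congr (_ *: _).
  apply: eq_sn_d => z.
  by rewrite anchorM scalarD !scale_tensor addrC (mulrC _ c).
by rewrite !adaD IHu IHv !scalerDr addrACA.
Qed.

Let lieC x y : lie L x y = - lie L y x.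
Proof.
apply/eqP; rewrite -addr_eq0; apply/eqP.
by have := liexx L (x + y); rewrite lieDl !lieDr !liexx add0r addr0.
Qed.

Let adxZ c x u : sn_adx (c *: x) u = c *: sn_adx x u + lmul x (sn_ada c u).
Proof.
elim/(@ext_ind A g): u => [a s|u v IHu IHv]; last first.
  by rewrite !(adxD, adaD, lmulD) IHu IHv scalerDr addrACA.
rewrite !adxE adaE anchorA -scale_tensor scalerDr addrAC; congr (_ + _).
rewrite lmulZ scalerA (mulrC c a) (mulrC _ a) -!scalerA -scalerDr; congr (_ *: _).
elim: s => [|y s IHs] /=; first by rewrite lmul0 !scaler0 addr0.
have -> : wedge [:: lie L (c *: x) y] =
    c *: wedge [:: lie L x y] - lmul x (ext_scalar g (anchor L y c)).
  have -> : lie L (c *: x) y = c *: lie L x y + (- anchor L y c) *: x.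
    by rewrite lieC lie_leibniz (lieC x y) scalerN opprD scaleNr addrC.
  rewrite /wedge (tensorD _ [::]) !(tensorZ _ _ [::]) lmulE !mul1r scale_tensor mulr1.
  by rewrite -[- anchor _ _ _]mulN1r -scale_tensor scaleN1r.
set D := ext_scalar g _; rewrite exprS mulN1r.
have := lmulsC s x D; move: ((-1) ^+ size s) IHs => k IHs kD.
rewrite IHs -[- lmul x D]scaleN1r lmulsD !lmulsZ kD !lmulD !lmulZ (lmulC x y).
by rewrite !scalerDr !scalerA addrACA scalerN scaleNr opprK mulrN1 (mulrC k c).
Qed.

Let schouten_compat v : ext_compat (sn_der (sn_adx ^~ v) (sn_ada ^~ v)).
Proof.
apply: sn_der_compat => *; first exact: adxDl.
- exact: adaDl.
- exact: adxZ.
- exact: adaM.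
Qed.

Let schoutenE a s v : schouten (tensor a s) v =
  a *: sn_d (sn_adx ^~ v) s + lmuls s (sn_ada a v).
Proof. by rewrite /schouten (ext_liftE (schouten_compat v)). Qed.

Let schoutenD u u' v : schouten (u + u') v = schouten u v + schouten u' v.
Proof. exact: (ext_liftD (schouten_compat v)). Qed.

Let sn_dDv s u v :
  sn_d (sn_adx ^~ (u + v)) s = sn_d (sn_adx ^~ u) s + sn_d (sn_adx ^~ v) s.
Proof. by rewrite -sn_dD; apply: eq_sn_d => x; rewrite adxD. Qed.

Let ada1 v : sn_ada 1 v = 0.
Proof.
elim/(@ext_ind A g): v => [a s|u v IHu IHv]; last by rewrite adaD IHu IHv addr0.
rewrite adaE (@eq_sn_d _ (fun y => 0 *: 0)) ?sn_dZ ?scale0r ?scaler0 // => y.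
by rewrite anchor1 scalar0.
Qed.

Let size_del (s : seq g) i : (i < size s)%N -> size (del i s) = (size s).-1.
Proof. by move=> lti; rewrite size_cat size_takel ?size_drop; lia. Qed.

Let sgn2 n m (u : exterior g) : odd n = odd m -> (-1) ^+ n *: u = (-1) ^+ m *: u.
Proof. by move=> nm; rewrite -signr_odd nm signr_odd. Qed.

Lemma schouten_spec : is_schouten L schouten.
Proof.
split=> [u v w|u v w|a b|s a s0|a s s0|s t s0 t0].
- exact: schoutenD.
- elim/(@ext_ind A g): u => [a s|u u' IHu IHu'].
    by rewrite !schoutenE adaD lmulsD sn_dDv scalerDr addrACA.
  by rewrite !schoutenD IHu IHu' addrACA.
- by rewrite schoutenE /= adaE /= !scaler0 addr0.
- rewrite schoutenE ada1 lmuls0 addr0 scale1r sn_dE; apply: eq_bigr => i _.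
  by rewrite adxE /= scaler0 add0r lmulsE cats0 -scalerA -tensorE.
- rewrite schoutenE /= scaler0 add0r adaE mulr1 sn_dE scaler_sumr.
  apply: eq_bigr => i _.
  rewrite lmulsE cats0 scalerA -exprD tensorE -scalerA.
  by apply: sgn2; have := ltn_ord i; lia.
- rewrite schoutenE ada1 lmuls0 addr0 scale1r sn_dE; apply: eq_bigr => i _.
  rewrite adxE anchor1 scale1r; have -> : tensor 0 t = 0 :> exterior g.
    by rewrite tensorE scale0r.
  rewrite addr0 sn_dE (big_morph _ (lmulsD _) (lmuls0 _)) scaler_sumr.
  apply: eq_bigr => j _; rewrite lmulsZ.
  rewrite -[wedge [:: _]](lmulE _ 1 [::]) lmulsC lmulsZ lmulsC lmulsE cats0 lmulsE.
  rewrite !scalerA -!exprD lmulE !size_del //.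
  by apply: sgn2; have := ltn_ord i; have := ltn_ord j; lia.
Qed.
End Existence.

Lemma is_schouten_unique (R : realType) (A : comPzRingType) (g : lmodType A)
    (L : lieRinehart R g) br1 br2 :
  is_schouten L br1 -> is_schouten L br2 -> forall u v, br1 u v = br2 u v.
Proof.
move=> H1 H2 u v; elim/(@ext_ind A g): u => [a s|u u' IHu IHu']; last first.
  by rewrite (schoutenDl H1) (schoutenDl H2) IHu IHu'.
elim/(@ext_ind A g): v => [b t|v v' IHv IHv']; last first.
  by rewrite (schoutenDr H1) (schoutenDr H2) IHv IHv'.
have wE (c : A) x r : tensor c (x :: r) = wedge ((c *: x) :: r).
  by rewrite /wedge (tensorZ _ _ [::]) mul1r.
case: s => [|x s]; case: t => [|y t]; rewrite ?wE.
- by rewrite (schouten_scalar H1) (schouten_scalar H2).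
- by rewrite (schouten_scalar_wedge H1) ?(schouten_scalar_wedge H2).
- by rewrite (schouten_wedge_scalar H1) ?(schouten_wedge_scalar H2).
- by rewrite (schouten_wedge H1) ?(schouten_wedge H2).
Qed.

(* Main.v *)
Require Import Defs.
From mathcomp Require Import all_boot all_algebra.
From mathcomp Require Import reals.

Import GRing.Theory.
Local Open Scope ring_scope.

(** The bracket is determined by biadditivity and its values on scalars and on
    simple tensors, since a coefficient of a nonempty simple tensor can be moved
    into its first letter (tensor_cons). The exterior map [ext_map f phi] sends
    a simple tensor to the simple tensor of the images of its letters, so it
    suffices to apply it to the defining sums: omission of a letter commutes
    with [map phi], and [phi] and [f] carry the Lie bracket and the anchor,
    the only data from which the summands are built, to those of the target.
    Linearity over the reals and preservation of the degree follow from
    semilinearity with respect to [f] (ext_mapZ). *)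

Lemma tensor_cons (A : comPzRingType) (g : lmodType A) (a : A) x (s : seq g) :
  tensor a (x :: s) = wedge ((a *: x) :: s).
Proof. by rewrite /wedge (tensorZ _ _ [::]) mul1r. Qed.

(** An induction principle whose base cases are those for which the bracket is
    given by an explicit formula. *)
Lemma ext_ind_wedge (A : comPzRingType) (g : lmodType A)
    (P : exterior g -> Prop) :
    (forall a, P (ext_scalar g a)) ->
    (forall s : seq g, (0 < size s)%N -> P (wedge s)) ->
    (forall u v, P u -> P v -> P (u + v)) ->
  forall u, P u.
Proof.
move=> Pa Pw PD u; elim/(@ext_ind A g): u => [a [|x s]|]; last exact: PD.
  exact: Pa.
by rewrite tensor_cons; exact: Pw.
Qed.

Lemma map_del (T U : Type) (k : T -> U) i s : map k (del i s) = del i (map k s).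
Proof. by rewrite /del map_cat map_take map_drop. Qed.

Section ExteriorMap.
Context {A B : comPzRingType} {g : lmodType A} {h : lmodType B}.
Context {f : {rmorphism A -> B}} {phi : {additive g -> h}}.
Hypothesis phiZ : forall a x, phi (a *: x) = f a *: phi x.
Local Notation F := (ext_map f phi).

Lemma ext_map0 : F 0 = 0.
Proof. by apply: (addIr (F 0)); rewrite -ext_mapD // !add0r. Qed.

Lemma ext_map_sum I (r : seq I) (G : I -> exterior g) :
  F (\sum_(i <- r) G i) = \sum_(i <- r) F (G i).
Proof. exact: (big_morph _ (ext_mapD phiZ) ext_map0). Qed.

Lemma ext_mapZ a u : F (a *: u) = f a *: F u.
Proof.
elim/(@ext_ind A g): u => [c s|u v IHu IHv].
  by rewrite tensorE scalerA !ext_mapE // rmorphM scalerA.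
by rewrite scalerDr !ext_mapD // IHu IHv scalerDr.
Qed.

Lemma ext_map_homog n u : ext_homog n u -> ext_homog n (F u).
Proof.
case=> r ->; exists [seq (f p.1, map_tuple phi p.2) | p <- r].
rewrite ext_map_sum big_map; apply: eq_bigr => p _.
by rewrite ext_mapE.
Qed.

(** Beyond the end of [s] both sides are the default value, as [phi 0 = 0]. *)
Lemma nth_map0 (s : seq g) i : (map phi s)`_i = phi s`_i.
Proof.
have [lti|lei] := ltnP i (size s); first exact: nth_map.
by rewrite !nth_default ?size_map // raddf0.
Qed.
End ExteriorMap.

Theorem proposition2p18 (R : realType) (A B : comPzRingType)
    (g : lmodType A) (h : lmodType B)
    (L : lieRinehart R g) (M : lieRinehart R h)
    (f : {rmorphism A -> B}) (phi : {additive g -> h})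
    (brg : exterior g -> exterior g -> exterior g)
    (brh : exterior h -> exterior h -> exterior h)
    (fphiP : lieRinehart_morphism L M f phi)
    (brgP : is_schouten L brg) (brhP : is_schouten M brh) :
  graded_lie_morphism L M brg brh (ext_map f phi).
Proof.
have phiZ := morph_scale fphiP.
split=> [u v|r u|n u|u v]; first exact: ext_mapD.
- by rewrite ext_mapZ // (morph_algr fphiP).
- exact: ext_map_homog.
elim/(@ext_ind_wedge A g): u => [a|s s0|u u' IHu IHu'].
- elim/(@ext_ind_wedge A g): v => [b|t t0|v v' IHv IHv'].
  + rewrite (schouten_scalar brgP) !ext_map_scalar // (schouten_scalar brhP).
    exact: ext_map0.
  + rewrite (schouten_scalar_wedge brgP) // ext_map_scalar // ext_map_wedge //.
    rewrite (schouten_scalar_wedge brhP) ?size_map // ext_map_sum //.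
    apply: eq_bigr => i _; rewrite ext_mapE // rmorphM rmorph_sign map_del.
    by rewrite (morph_anchor fphiP) nth_map0.
  + by rewrite (schoutenDr brgP) !ext_mapD // (schoutenDr brhP) IHv IHv'.
- elim/(@ext_ind_wedge A g): v => [b|t t0|v v' IHv IHv'].
  + rewrite (schouten_wedge_scalar brgP) // ext_map_scalar // ext_map_wedge //.
    rewrite (schouten_wedge_scalar brhP) ?size_map // ext_map_sum //.
    apply: eq_bigr => i _; rewrite ext_mapE // rmorphM rmorph_sign map_del.
    by rewrite (morph_anchor fphiP) nth_map0.
  + rewrite (schouten_wedge brgP) // !ext_map_wedge //.
    rewrite (schouten_wedge brhP) ?size_map // ext_map_sum //.
    apply: eq_bigr => i _; rewrite ext_map_sum //; apply: eq_bigr => j _.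
    rewrite ext_mapE // rmorph_sign /= map_cat !map_del (morph_lie fphiP).
    by rewrite !nth_map0.
  + by rewrite (schoutenDr brgP) !ext_mapD // (schoutenDr brhP) IHv IHv'.
- by rewrite (schoutenDl brgP) !ext_mapD // (schoutenDl brhP) IHu IHu'.
Qed.
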